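(* Let $N=2^n$ and let ${\cal B}:\mathbb{C}^{N\times N}\to\mathbb{C}^m$ be a linear map such that ${\cal B}{\cal H}^{-1}:\mathbb{C}^{N\times N}\to\mathbb{C}^m$ has the restricted isometry property of order $2s$ and level $\delta<1$, where ${\cal H}$ is the discrete bivariate Haar transform. Suppose that $\mathbf{D}\in\mathbb{C}^{N\times N}$ satisfies the tube constraint $\|{\cal B}(\mathbf{D})\|_2\le\varepsilon$. Then $$\|\mathbf{D}\|_2\lesssim\Big(\frac{\|\mathbf{D}\|_{TV}}{\sqrt{s}}\Big)\log(N^2/s)+\varepsilon.$$
   Context: Notation: $u\lesssim v$ means $u\le Cv$ for a constant $C>0$ (called absolute in the paper). $\|\cdot\|_2$ is the entrywise (Frobenius) norm. A linear map has the restricted isometry property of order $s$ and level $\delta$ if $(1-\delta)\|\mathbf{X}\|_2^2\le\|{\cal B}{\cal H}^{-1}(\mathbf{X})\|_2^2\le(1+\delta)\|\mathbf{X}\|_2^2$ (stated here for ${\cal B}{\cal H}^{-1}$) for all $\mathbf{X}$ with at most $s$ nonzero entries. Anisotropic total variation: $\|\mathbf{X}\|_{TV}=\sum_{j=1}^{N-1}\sum_{k=1}^N|X_{j+1,k}-X_{j,k}|+\sum_{j=1}^N\sum_{k=1}^{N-1}|X_{j,k+1}-X_{j,k}|$. Haar transform: $H^0=\mathbf{1}_{[0,1)}$, $H^1=\mathbf{1}_{[0,1/2)}-\mathbf{1}_{[1/2,1)}$; for $e=(e_1,e_2)\in\{(0,1),(1,0),(1,1)\}$, $H^e(u,v)=H^{e_1}(u)H^{e_2}(v)$,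 $H^e_{j,k}(x)=2^jH^e(2^jx-k)$, $j\ge0$, $k\in\mathbb{Z}^2\cap2^j[0,1)^2$. Identifying $\mathbf{X}\in\mathbb{C}^{N\times N}$ isometrically with the function equal to $NX_{j,k}$ on $[\frac{j-1}{N},\frac jN)\times[\frac{k-1}{N},\frac kN)$, the constant function and $\{H^e_{j,k}:j\le n-1\}$ give an orthonormal basis of $\mathbb{C}^{N\times N}$ (inner product $\mathrm{tr}(\mathbf{X}\mathbf{Y}^* )$); ${\cal H}(\mathbf{X})$ is the $N\times N$ array of coefficients of $\mathbf{X}$ in this basis.
   Formalization: The constant in ≲ may depend on the level δ (an absolute constant is impossible as δ→1: take B=√(1−δ)·H and D constant), and s is an integer with 1 ≤ s ≤ N², since the bound is undefined at s=0 and fails for s>N², where the logarithm is negative. *)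

(* Defs.v *)
From HB Require Import structures.
From mathcomp Require Import all_boot all_order all_algebra.
From mathcomp Require Import all_classical all_reals.
From mathcomp Require Import exp.
From mathcomp Require Import complex.
Set Implicit Arguments. Unset Strict Implicit. Unset Printing Implicit Defensive.
Import Order.TTheory GRing.Theory Num.Theory.
Local Open Scope ring_scope.

Section Defs.
Variable R : realType.
Local Notation C := R[i].

Definition cabs (z : C) : R := let: Complex a b := z in Num.sqrt (a ^+ 2 + b ^+ 2).

Definition frob {m n : nat} (X : 'M[C]_(m, n)) : R :=
  Num.sqrt (\sum_(a < m) \sum_(b < n) cabs (X a b) ^+ 2).

Definition nnz {m n : nat} (X : 'M[C]_(m, n)) : nat :=
  #|[set ab : 'I_m * 'I_n | X ab.1 ab.2 != 0]|.

Definition TV {N : nat} (X : 'M[C]_N) : R :=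
  \sum_(a < N) \sum_(a' < N | val a' == (val a).+1) \sum_(b < N)
       cabs (X a' b - X a b)
  + \sum_(a < N) \sum_(b < N) \sum_(b' < N | val b' == (val b).+1)
       cabs (X a b' - X a b).

Definition H0 (x : R) : R := if (0 <= x) && (x < 1) then 1 else 0.
Definition H1 (x : R) : R :=
  if (0 <= x) && (x < 2^-1) then 1
  else if (2^-1 <= x) && (x < 1) then -1 else 0.
Definition Hu (e : bool) : R -> R := if e then H1 else H0.

Definition Haar2 (e : bool * bool) (j : nat) (k : nat * nat) (u v : R) : R :=
  2 ^+ j * Hu e.1 (2 ^+ j * u - (k.1)%:R) * Hu e.2 (2 ^+ j * v - (k.2)%:R).

(* Identification of X in C^{N x N} with the function equal to N X_{a,b} on
   the cell [a/N,(a+1)/N) x [b/N,(b+1)/N) (0-based a,b).  For j <= n-1 the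
   Haar function is constant on cells, so the L^2 function g corresponds to
   the matrix with entries (1/N) g(a/N, b/N).  *)
Definition fun_mx (n : nat) (g : R -> R -> R) : 'M[C]_(2 ^ n) :=
  \matrix_(a, b) ((((2 ^ n)%:R)^-1 * g ((val a)%:R / (2 ^ n)%:R)
                                       ((val b)%:R / (2 ^ n)%:R))%:C)%C.

(* Arrangement of the orthonormal basis {1} U {H^e_{j,k} : j <= n-1} into an
   N x N array (standard 2-D wavelet pyramid layout):
   position (0,0)                     : the constant function 1,
   position (k1, 2^j + k2)            : H^{(0,1)}_{j,(k1,k2)},
   position (2^j + k1, k2)            : H^{(1,0)}_{j,(k1,k2)},
   position (2^j + k1, 2^j + k2)      : H^{(1,1)}_{j,(k1,k2)},
   for 0 <= j <= n-1 and 0 <= k1,k2 < 2^j. *)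
Definition haar_basis_fun (p q : nat) : R -> R -> R :=
  if (p == 0%N) && (q == 0%N) then (fun u v => H0 u * H0 v)
  else
    let j := trunc_log 2 (maxn p q) in
    if (p < 2 ^ j)%N then Haar2 (false, true) j (p, (q - 2 ^ j)%N)
    else if (q < 2 ^ j)%N then Haar2 (true, false) j ((p - 2 ^ j)%N, q)
    else Haar2 (true, true) j ((p - 2 ^ j)%N, (q - 2 ^ j)%N).

Definition haar_basis (n : nat) (p q : 'I_(2 ^ n)) : 'M[C]_(2 ^ n) :=
  fun_mx n (haar_basis_fun p q).

Definition Haar_inv (n : nat) (Y : 'M[C]_(2 ^ n)) : 'M[C]_(2 ^ n) :=
  \sum_(p < 2 ^ n) \sum_(q < 2 ^ n) Y p q *: haar_basis p q.

(* Discrete Haar transform: coefficients w.r.t. the basis, inner product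
   tr(X Y^H), the basis being real. *)
Definition Haar (n : nat) (X : 'M[C]_(2 ^ n)) : 'M[C]_(2 ^ n) :=
  \matrix_(p, q) \sum_(a < 2 ^ n) \sum_(b < 2 ^ n) X a b * haar_basis p q a b.

Definition RIP {N m : nat} (A : 'M[C]_N -> 'cV[C]_m) (s : nat) (delta : R) :=
  forall X : 'M[C]_N, (nnz X <= s)%N ->
    (1 - delta) * frob X ^+ 2 <= frob (A X) ^+ 2 <= (1 + delta) * frob X ^+ 2.

End Defs.

(* Main.v *)
(* For each type e, the Haar coefficients of one scale have l1 norm at most
   ||D||_TV: H^e has mean zero in one of its variables, so a coefficient on a
   dyadic square is bounded by the variation of D on that square.
   Let S be the set of coefficients of scale below j, where 4^j <= s < 4^(j+1);
   then |S| <= s, and only n - j, which is O(log(N^2/s)), scales lie outside S.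
   Hence the coefficients outside S have l1 norm O(||D||_TV log(N^2/s)), and no
   rearrangement of the coefficients by size over all scales is needed.
   Cutting the complement of S into blocks of s coefficients in decreasing
   order, the restricted isometry property of order 2s controls S and the first
   block by epsilon plus the other blocks, and the l2 norms of the latter sum to
   at most the l1 norm of the complement divided by sqrt s. *)

Require Import Defs.
From HB Require Import structures.
From mathcomp Require Import all_boot all_order all_algebra.
From mathcomp Require Import all_classical all_reals.
From mathcomp Require Import exp.
From mathcomp Require Import complex.
From mathcomp Require Import zify ring lra.
Import Order.TTheory GRing.Theory Num.Theory.
Local Open Scope ring_scope.

(** * Modulus, Frobenius norm and restriction to index sets *)

Section Norms.
Variable R : realType.
#[local] Set Implicit Arguments.
#[local] Unset Strict Implicit.
Implicit Types z : R[i].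

(** Carries the triangle inequality and multiplicativity over from the norm of [R[i]], whose values
    are complex, to the real-valued [cabs]. *)
Lemma normc_cabs z : `|z| = ((cabs z)%:C)%C.
Proof. by case: z => a b; rewrite normc_def. Qed.

Lemma cabs_ge0 z : 0 <= cabs z.
Proof. by case: z => a b; exact: sqrtr_ge0. Qed.

Lemma cabs0 : cabs (0 : R[i]) = 0.
Proof. by rewrite /cabs /= expr0n /= addr0 sqrtr0. Qed.

Lemma cabsD (x y : R[i]) : cabs (x + y) <= cabs x + cabs y.
Proof. by rewrite -lecR rmorphD -!normc_cabs ler_normD. Qed.

Lemma cabsM (x y : R[i]) : cabs (x * y) = cabs x * cabs y.
Proof. by apply: complexI; rewrite rmorphM -!normc_cabs normrM. Qed.

Lemma cabs_real (r : R) : cabs (r%:C)%C = `|r|.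
Proof. by rewrite /cabs /= expr0n /= addr0 sqrtr_sqr. Qed.

Lemma cabs_sum (I : Type) (r : seq I) (P : pred I) (F : I -> R[i]) :
  cabs (\sum_(i <- r | P i) F i) <= \sum_(i <- r | P i) cabs (F i).
Proof.
apply: (big_ind2 (fun x y => cabs x <= y)) => //; first by rewrite cabs0.
by move=> x1 x2 y1 y2 h1 h2; apply: le_trans (cabsD _ _) (lerD h1 h2).
Qed.

Lemma cabs_sqr z : cabs z ^+ 2 = complex.Re z ^+ 2 + complex.Im z ^+ 2.
Proof. by case: z => a b; rewrite /cabs sqr_sqrtr ?addr_ge0 ?sqr_ge0. Qed.

Section Frobenius.
Variables m n : nat.
Implicit Types X Y : 'M[R[i]]_(m, n).
Implicit Types U V : {set 'I_m * 'I_n}.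

Lemma frob_ge0 X : 0 <= frob X.
Proof. exact: sqrtr_ge0. Qed.

Lemma frob_sqr X : frob X ^+ 2 = \sum_(i : 'I_m * 'I_n) cabs (X i.1 i.2) ^+ 2.
Proof.
rewrite /frob sqr_sqrtr; first by rewrite pair_bigA.
by apply: sumr_ge0 => a _; apply: sumr_ge0 => b _; exact: sqr_ge0.
Qed.

(* For x, y > 0 with x >= |X|, y >= |Y|, sum the pointwise bound
   |u + v|^2 <= (1 + y/x) |u|^2 + (1 + x/y) |v|^2. *)
Lemma frobD X Y : frob (X + Y) <= frob X + frob Y.
Proof.
apply/ler_addgt0Pr => e e0.
set x := frob X + e / 2; set y := frob Y + e / 2.
have X0 := frob_ge0 X; have Y0 := frob_ge0 Y.
have x0 : 0 < x by rewrite /x; lra.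
have y0 : 0 < y by rewrite /y; lra.
have -> : frob X + frob Y + e = x + y by rewrite /x /y; lra.
rewrite -(@ler_pXn2r _ 2) ?nnegrE ?frob_ge0 //; last lra.
have hX : frob X ^+ 2 <= x ^+ 2 by rewrite ler_pXn2r ?nnegrE // /x; lra.
have hY : frob Y ^+ 2 <= y ^+ 2 by rewrite ler_pXn2r ?nnegrE // /y; lra.
have -> : (x + y) ^+ 2 = (1 + y / x) * x ^+ 2 + (1 + x / y) * y ^+ 2.
  by field; rewrite !gt_eqF.
apply: le_trans (lerD (ler_wpM2l _ hX) (ler_wpM2l _ hY)); last 2 first.
- by rewrite addr_ge0 // divr_ge0 // ltW.
- by rewrite addr_ge0 // divr_ge0 // ltW.
rewrite !frob_sqr !mulr_sumr -big_split /=; apply: ler_sum => i _.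
rewrite mxE; set u := X _ _; set v := Y _ _.
apply: (@le_trans _ _ ((cabs u + cabs v) ^+ 2)).
  by rewrite ler_pXn2r ?nnegrE ?addr_ge0 ?cabs_ge0 // cabsD.
rewrite -subr_ge0; set p := cabs u; set q := cabs v.
suff -> : (1 + y / x) * p ^+ 2 + (1 + x / y) * q ^+ 2 - (p + q) ^+ 2 =
          (y * p - x * q) ^+ 2 / (x * y).
  by rewrite divr_ge0 ?sqr_ge0 // mulr_ge0 // ltW.
by field; rewrite !gt_eqF.
Qed.

Definition mxmask X (U : {set 'I_m * 'I_n}) : 'M[R[i]]_(m, n) :=
  \matrix_(p, q) if (p, q) \in U then X p q else 0.

Lemma mxmask_setU X U V :
  [disjoint U & V] -> mxmask X (U :|: V) = mxmask X U + mxmask X V.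
Proof.
move=> dUV; apply/matrixP => p q; rewrite !mxE finset.in_setU.
have [pU|] := boolP ((p, q) \in U); last by rewrite add0r.
by rewrite (disjointFr dUV pU) addr0.
Qed.

Lemma mxmask_setT X : mxmask X [set: 'I_m * 'I_n] = X.
Proof. by apply/matrixP => p q; rewrite mxE inE. Qed.

Lemma nnz_mxmask X U : (nnz (mxmask X U) <= #|U|)%N.
Proof.
apply/subset_leq_card/fintype.subsetP => -[p q]; rewrite inE mxE /=.
by case: ifP => //; rewrite eqxx.
Qed.

Lemma frob_mxmask_sqr X U :
  frob (mxmask X U) ^+ 2 = \sum_(i in U) cabs (X i.1 i.2) ^+ 2.
Proof.
rewrite frob_sqr [RHS]big_mkcond /=; apply: eq_bigr => -[p q] _.
by rewrite mxE; case: ifP => // _; rewrite cabs0 expr0n.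
Qed.

Lemma frob_mxmask_le X U (s : nat) (t : R) : (#|U| <= s)%N -> 0 <= t ->
  (forall i, i \in U -> cabs (X i.1 i.2) <= t) ->
  frob (mxmask X U) <= Num.sqrt s%:R * t.
Proof.
move=> Us t0 Ut; rewrite -(@ler_pXn2r _ 2) ?nnegrE ?frob_ge0 //; last first.
  by rewrite mulr_ge0 ?sqrtr_ge0.
rewrite frob_mxmask_sqr exprMn sqr_sqrtr //.
apply: (@le_trans _ _ (\sum_(i in U) t ^+ 2)).
  by apply: ler_sum => i iU; rewrite ler_pXn2r ?nnegrE ?cabs_ge0 // Ut.
by rewrite sumr_const -[leLHS]mulr_natl ler_wpM2r ?sqr_ge0 // ler_nat.
Qed.

End Frobenius.
End Norms.

(** * Cutting a family into blocks of decreasing size *)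

Section Blocks.
Variables (R : realType) (T : finType) (x : T -> R).
Hypothesis x_ge0 : forall i, 0 <= x i.

(** Induction on [s]: adjoin to [V] a maximiser of [x] on the remainder; its value is the new
    threshold [t]. *)
Lemma top_set (s : nat) (U : {set T}) : (s < #|U|)%N ->
  exists (V : {set T}) (t : R), [/\ V \subset U, #|V| = s.+1, 0 <= t,
    forall i, i \in V -> t <= x i & forall j, j \in U :\: V -> x j <= t].
Proof.
elim: s U => [|s IH] U sU.
  have [i0 i0U] : exists i, i \in U by apply/card_gt0P.
  have [i iU imax] := @arg_maxP _ R T i0 (mem U) x i0U.
  exists [set i], (x i); split; rewrite ?finset.sub1set ?cards1 //.
    by move=> j; rewrite inE => /eqP ->.
  by move=> j; rewrite !inE => /andP[_ /imax].
have [V [t [VU cV t0 Vt tU]]] := IH U (ltnW sU).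
have [i0 i0U] : exists i, i \in U :\: V.
  apply/card_gt0P; rewrite cardsD (finset.setIidPr VU) cV subn_gt0.
  exact: sU.
have [i iU imax] := @arg_maxP _ R T i0 (mem (U :\: V)) x i0U.
have := iU : i \in U :\: V; rewrite !inE => /andP[iV iU'].
exists (i |: V), (x i); split => //.
- by rewrite finset.subUset finset.sub1set iU'.
- by rewrite cardsU1 iV cV.
- move=> j; rewrite !inE => /orP[/eqP -> //|jV].
  exact: le_trans (tU _ iU) (Vt _ jV).
- move=> j; rewrite !inE negb_or => /andP[/andP[_ jV] jU].
  by apply: imax; apply: (_ : j \in U :\: V); rewrite !inE jV.
Qed.

(** The [s.+1] entries of [V] sum to at least [s.+1 * t], so the l1 mass of one block pays for the
    entry bound [t] on the next. *)
Lemma top_peel (s : nat) (U V : {set T}) (t : R) :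
  V \subset U -> #|V| = s.+1 -> (forall i, i \in V -> t <= x i) ->
  Num.sqrt s.+1%:R * t + (\sum_(i in U :\: V) x i) / Num.sqrt s.+1%:R <=
  (\sum_(i in U) x i) / Num.sqrt s.+1%:R.
Proof.
move=> VU cV Vt; have r0 : 0 < Num.sqrt s.+1%:R :> R by rewrite sqrtr_gt0 ltr0n.
rewrite [in leRHS](big_setID V) /= (finset.setIidPr VU) mulrDl lerD2r.
rewrite ler_pdivlMr // mulrAC -expr2 sqr_sqrtr //.
rewrite mulr_natl -cV -sumr_const; exact: ler_sum.
Qed.

(* Peel off the s largest entries of U: on what remains the entries are at
   most their minimum, which is at most their l1 norm divided by s. *)
Lemma block_bound (G : {set T} -> R) (s : nat) : (0 < s)%N ->
  (forall U V : {set T}, [disjoint U & V] -> G (U :|: V) <= G U + G V) ->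
  (forall (U : {set T}) t, (#|U| <= s)%N -> 0 <= t -> (forall i, i \in U -> x i <= t) ->
     G U <= Num.sqrt s%:R * t) ->
  forall (U : {set T}) t, 0 <= t -> (forall i, i \in U -> x i <= t) ->
    G U <= Num.sqrt s%:R * t + (\sum_(i in U) x i) / Num.sqrt s%:R.
Proof.
move=> s0 GU Gs U; have [k] := ubnP #|U|; elim: k U => // k IH U cU t t0 Ut.
have r0 : 0 < Num.sqrt s%:R :> R by rewrite sqrtr_gt0 ltr0n.
have [Us|sU] := leqP #|U| s.
  apply: le_trans (Gs _ _ Us t0 Ut) _.
  by rewrite lerDl divr_ge0 ?sumr_ge0 // ltW.
case: s s0 Gs IH r0 sU => // s _ Gs IH r0 sU.
have [V [v [VU cV v0 Vv vU]]] := top_set _ _ (ltnW sU).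
have dis : [disjoint V & U :\: V].
  by rewrite -finset.setI_eq0; apply/eqP/setP => j; rewrite !inE; case: (j \in V).
have eU : U = V :|: U :\: V by rewrite -{1}(finset.setID U V) (finset.setIidPr VU).
rewrite [in leLHS]eU; apply: le_trans (GU _ _ dis) _; apply: lerD.
  by apply: Gs => //; [rewrite cV | move=> i /(fintype.subsetP VU)/Ut].
have cD : (#|U :\: V| < k)%N.
  by rewrite cardsD (finset.setIidPr VU) cV; lia.
exact: le_trans (IH _ cD v v0 vU) (top_peel _ _ _ _ VU cV Vv).
Qed.

End Blocks.

(** * The Haar basis and its completeness relation *)

Section Haar.
Variable R : realType.
#[local] Set Implicit Arguments.
#[local] Unset Strict Implicit.

Lemma H0_double (x : R) :
  H0 (2 * x) = (if (0 <= x) && (x < 2^-1) then 1 else 0) /\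
  H0 (2 * x - 1) = (if (2^-1 <= x) && (x < 1) then 1 else 0).
Proof.
have e1 : (0 <= 2 * x) = (0 <= x) by apply/idP/idP; lra.
have e2 : (2 * x < 1) = (x < 2^-1) by apply/idP/idP; lra.
have e3 : (0 <= 2 * x - 1) = (2^-1 <= x) by apply/idP/idP; lra.
have e4 : (2 * x - 1 < 1) = (x < 1) by apply/idP/idP; lra.
by rewrite /H0 e1 e2 e3 e4.
Qed.

Lemma H0_two_scale (x : R) : H0 x = H0 (2 * x) + H0 (2 * x - 1).
Proof.
have [-> ->] := H0_double x; rewrite /H0.
by case: (lerP 0 x) => ?; case: (ltrP x 1) => ?; case: (ltrP x 2^-1) => ? /=; lra.
Qed.

Lemma H1_two_scale (x : R) : H1 x = H0 (2 * x) - H0 (2 * x - 1).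
Proof.
have [-> ->] := H0_double x; rewrite /H1.
by case: (lerP 0 x) => ?; case: (ltrP x 1) => ?; case: (ltrP x 2^-1) => ? /=; lra.
Qed.

Lemma Hu_le_H0 e (x : R) : `|Hu e x| <= H0 x.
Proof.
case: e; rewrite /Hu /H1 /H0.
  case: (lerP 0 x) => ?; case: (ltrP x 1) => ?; case: (ltrP x 2^-1) => ?;
  rewrite /= ?normrN1 ?normr1 ?normr0 //; lra.
by case: ifP; rewrite ?normr1 ?normr0.
Qed.

Lemma sum_ord_double (V : nmodType) (m : nat) (F : nat -> V) :
  \sum_(k < m.*2) F k = \sum_(k < m) (F k.*2 + F k.*2.+1).
Proof.
elim: m => [|m IH]; first by rewrite !big_ord0.
by rewrite doubleS !big_ord_recr /= IH addrA.
Qed.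

(** Up to the factor [2 ^ L], the kernel of the orthogonal projection onto the dyadic step functions
    of scale [L] for [H0], and onto the span of the Haar functions of scale [L] for [H1]. *)
Definition scale_kernel (H : R -> R) (L : nat) (u v : R) : R :=
  \sum_(k < 2 ^ L) H (2 ^+ L * u - k%:R) * H (2 ^+ L * v - k%:R).

(** Multiresolution in one variable: [H0] and [H1] are the sum and the difference of the indicators
    of the two halves, so the mixed products cancel. *)
Lemma scale_kernel_step L u v :
  scale_kernel (@H0 R) L u v + scale_kernel (@H1 R) L u v =
  2 * scale_kernel (@H0 R) L.+1 u v.
Proof.
rewrite /scale_kernel expnS mul2n.
rewrite (sum_ord_double (2 ^ L)
  (fun k => H0 (2 ^+ L.+1 * u - k%:R) * H0 (2 ^+ L.+1 * v - k%:R))).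
rewrite -big_split mulr_sumr; apply: eq_bigr => k _ /=.
rewrite !(H0_two_scale (2 ^+ L * _ - _)) !H1_two_scale.
have E (w : R) : 2 * (2 ^+ L * w - k%:R) = 2 ^+ L.+1 * w - k.*2%:R.
  by rewrite exprS -muln2 natrM; ring.
have E' (w : R) : 2 ^+ L.+1 * w - k.*2%:R - 1 = 2 ^+ L.+1 * w - k.*2.+1%:R.
  by rewrite -[k.*2.+1%:R]natr1; ring.
rewrite !E !E'; ring.
Qed.

(** For [m = 2 ^ L] the four quadrants are, in the pyramid layout, the coarser coefficients and the
    three types of scale [L]. *)
Lemma sum_box_double (V : nmodType) (m : nat) (F : nat -> nat -> V) :
  \sum_(p < m.*2) \sum_(q < m.*2) F p q =
  \sum_(p < m) \sum_(q < m) F p q +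
  (\sum_(p < m) \sum_(q < m) F p (m + q)%N +
   (\sum_(p < m) \sum_(q < m) F (m + p)%N q +
    \sum_(p < m) \sum_(q < m) F (m + p)%N (m + q)%N)).
Proof.
rewrite -addnn big_split_ord /=.
under eq_bigr => p _ do rewrite big_split_ord /=.
under [X in _ + X]eq_bigr => p _ do rewrite big_split_ord /=.
by rewrite !big_split /= !addrA.
Qed.

Lemma haar_basis_fun01 L p q : (p < 2 ^ L)%N -> (q < 2 ^ L)%N ->
  @haar_basis_fun R p (2 ^ L + q) = @Haar2 R (false, true) L (p, q).
Proof.
move=> pL qL; rewrite /haar_basis_fun.
have -> : trunc_log 2 (maxn p (2 ^ L + q)) = L.
  by apply: trunc_log_eq => //; rewrite expnS; lia.
have -> : (p == 0%N) && ((2 ^ L + q)%N == 0%N) = false by lia.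
by rewrite pL addKn.
Qed.

Lemma haar_basis_fun10 L p q : (p < 2 ^ L)%N -> (q < 2 ^ L)%N ->
  @haar_basis_fun R (2 ^ L + p) q = @Haar2 R (true, false) L (p, q).
Proof.
move=> pL qL; rewrite /haar_basis_fun.
have -> : trunc_log 2 (maxn (2 ^ L + p) q) = L.
  by apply: trunc_log_eq => //; rewrite expnS; lia.
have -> : ((2 ^ L + p)%N == 0%N) && (q == 0%N) = false by lia.
by rewrite ltnNge leq_addr qL addKn.
Qed.

Lemma haar_basis_fun11 L p q : (p < 2 ^ L)%N -> (q < 2 ^ L)%N ->
  @haar_basis_fun R (2 ^ L + p) (2 ^ L + q) = @Haar2 R (true, true) L (p, q).
Proof.
move=> pL qL; rewrite /haar_basis_fun.
have -> : trunc_log 2 (maxn (2 ^ L + p) (2 ^ L + q)) = L.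
  by apply: trunc_log_eq => //; rewrite expnS; lia.
have -> : ((2 ^ L + p)%N == 0%N) && ((2 ^ L + q)%N == 0%N) = false by lia.
by rewrite !ltnNge !leq_addr !addKn.
Qed.

Let expr4 (L : nat) : 4 ^+ L = (2 ^+ L) ^+ 2 :> R.
Proof. by rewrite -exprM mulnC exprM; congr (_ ^+ _); ring. Qed.

(** Induction on [L]: with kernels K0, K1 in each variable, the old square gives K0 K0 and the new
    quadrants K0 K1, K1 K0, K1 K1. Their sum factors as (K0 + K1)(K0 + K1), and each factor doubles
    into the next scale. *)
Lemma haar_box_kernel L u v u' v' :
  \sum_(p < 2 ^ L) \sum_(q < 2 ^ L)
    haar_basis_fun p q u v * haar_basis_fun p q u' v' =
  4 ^+ L * scale_kernel (@H0 R) L u u' * scale_kernel (@H0 R) L v v'.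
Proof.
elim: L => [|L IH].
  rewrite /scale_kernel expn0 !big_ord1 /= /haar_basis_fun /= !expr0; simpl.
  by rewrite !subr0 !mul1r; ring.
rewrite [in LHS]expnS [in LHS]mul2n (sum_box_double _
  (fun p q => haar_basis_fun p q u v * haar_basis_fun p q u' v')) IH.
have E01 : \sum_(p < 2 ^ L) \sum_(q < 2 ^ L)
    haar_basis_fun p (2 ^ L + q)%N u v * haar_basis_fun p (2 ^ L + q)%N u' v' =
    4 ^+ L * (scale_kernel (@H0 R) L u u' * scale_kernel (@H1 R) L v v').
  rewrite /scale_kernel big_distrlr mulr_sumr /=; apply: eq_bigr => p _.
  rewrite mulr_sumr; apply: eq_bigr => q _.
  rewrite haar_basis_fun01 ?ltn_ord // /Haar2 /=.
  by rewrite expr4; ring.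
have E10 : \sum_(p < 2 ^ L) \sum_(q < 2 ^ L)
    haar_basis_fun (2 ^ L + p)%N q u v * haar_basis_fun (2 ^ L + p)%N q u' v' =
    4 ^+ L * (scale_kernel (@H1 R) L u u' * scale_kernel (@H0 R) L v v').
  rewrite /scale_kernel big_distrlr mulr_sumr /=; apply: eq_bigr => p _.
  rewrite mulr_sumr; apply: eq_bigr => q _.
  rewrite haar_basis_fun10 ?ltn_ord // /Haar2 /=.
  by rewrite expr4; ring.
have E11 : \sum_(p < 2 ^ L) \sum_(q < 2 ^ L)
    haar_basis_fun (2 ^ L + p)%N (2 ^ L + q)%N u v *
    haar_basis_fun (2 ^ L + p)%N (2 ^ L + q)%N u' v' =
    4 ^+ L * (scale_kernel (@H1 R) L u u' * scale_kernel (@H1 R) L v v').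
  rewrite /scale_kernel big_distrlr mulr_sumr /=; apply: eq_bigr => p _.
  rewrite mulr_sumr; apply: eq_bigr => q _.
  rewrite haar_basis_fun11 ?ltn_ord // /Haar2 /=.
  by rewrite expr4; ring.
rewrite E01 E10 E11 exprS.
have Hu := scale_kernel_step L u u'; have Hv := scale_kernel_step L v v'.
transitivity (4 ^+ L *
  ((scale_kernel (@H0 R) L u u' + scale_kernel (@H1 R) L u u') *
   (scale_kernel (@H0 R) L v v' + scale_kernel (@H1 R) L v v'))); first by ring.
by rewrite Hu Hv; ring.
Qed.

Lemma H0_grid (j i a k : nat) :
  H0 (2 ^+ j * (a%:R / (2 ^ (j + i))%:R) - k%:R) = ((a %/ 2 ^ i)%N == k)%:R :> R.
Proof.
have j0 : 0 < 2 ^+ j :> R by rewrite exprn_gt0.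
have i0 : 0 < (2 ^ i)%:R :> R by rewrite ltr0n expn_gt0.
have -> : 2 ^+ j * (a%:R / (2 ^ (j + i))%:R) = a%:R / (2 ^ i)%:R :> R.
  by rewrite expnD natrM [(2 ^ j)%:R]natrX invfM mulrCA mulVKf ?gt_eqF.
rewrite /H0 subr_ge0 ler_pdivlMr // ltrBlDr ltr_pdivrMr // nat1r.
rewrite -!natrM ler_nat ltr_nat.
rewrite -leq_divRL ?expn_gt0 // -ltn_divLR ?expn_gt0 // ltnS eqn_leq andbC.
by case: (_ && _).
Qed.

Lemma sum_natr_eq (m c : nat) : (c < m)%N -> \sum_(k < m) (c == k)%:R = 1 :> R.
Proof.
move=> cm; rewrite (bigD1 (Ordinal cm)) //= eqxx big1 ?addr0 // => k.
by rewrite -val_eqE /= eq_sym => /negbTE ->.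
Qed.

(** At scale [n] each dyadic interval contains exactly one grid point. *)
Lemma scale_kernel_grid n (a b : 'I_(2 ^ n)) :
  scale_kernel (@H0 R) n ((val a)%:R / (2 ^ n)%:R) ((val b)%:R / (2 ^ n)%:R) =
  (a == b)%:R.
Proof.
rewrite /scale_kernel.
have G (c k : nat) : H0 (2 ^+ n * (c%:R / (2 ^ n)%:R) - k%:R) = (c == k)%:R :> R.
  by have := H0_grid n 0 c k; rewrite addn0 expn0 divn1.
under eq_bigr => k _ do rewrite !G.
rewrite (bigD1 a) //= eqxx mul1r big1 ?addr0 1?eq_sym // => k ka.
by rewrite [_ == nat_of_ord k]eq_sym val_eqE (negbTE ka) mul0r.
Qed.

(** The entries of [haar_basis] before embedding into the complex numbers; natural-number positions
    allow shifts by [2 ^ L]. *)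
Definition hmx n (p q : nat) (a b : 'I_(2 ^ n)) : R :=
  ((2 ^ n)%:R)^-1 * haar_basis_fun p q ((val a)%:R / (2 ^ n)%:R)
                                     ((val b)%:R / (2 ^ n)%:R).

Lemma haar_basisE n (p q a b : 'I_(2 ^ n)) :
  haar_basis R p q a b = ((hmx p q a b)%:C)%C.
Proof. by rewrite /haar_basis mxE. Qed.

(** The box kernel at [L = n], normalised by 4^n = N^2. Inversion and Parseval both follow from this
    relation. *)
Lemma hmx_complete n (a b a' b' : 'I_(2 ^ n)) :
  \sum_(p < 2 ^ n) \sum_(q < 2 ^ n) hmx p q a b * hmx p q a' b' =
  ((a, b) == (a', b'))%:R.
Proof.
have N0 : (2 ^ n)%:R != 0 :> R by rewrite pnatr_eq0 expn_eq0.
transitivity (((2 ^ n)%:R ^+ 2)^-1 * \sum_(p < 2 ^ n) \sum_(q < 2 ^ n)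
    @haar_basis_fun R p q ((val a)%:R / (2 ^ n)%:R) ((val b)%:R / (2 ^ n)%:R) *
    @haar_basis_fun R p q ((val a')%:R / (2 ^ n)%:R) ((val b')%:R / (2 ^ n)%:R)).
  rewrite mulr_sumr; apply: eq_bigr => p _; rewrite mulr_sumr.
  by apply: eq_bigr => q _; rewrite /hmx; field.
rewrite haar_box_kernel !scale_kernel_grid xpair_eqE -mulnb natrM !mulrA.
rewrite (_ : 4 ^+ n = (2 ^ n)%:R ^+ 2 :> R); first by rewrite mulVf ?mul1r ?expf_neq0.
by rewrite natrX expr4.
Qed.

End Haar.

(** * Reconstruction and Parseval from a completeness relation *)

Section CompleteFamily.
Variables (R : realType) (I J : finType) (K : I -> J -> R).
Hypothesis K_complete : forall x y, \sum_i K i x * K i y = (x == y)%:R.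

Lemma complete_recon (f : J -> R[i]) x :
  \sum_i (\sum_y f y * ((K i y)%:C)%C) * ((K i x)%:C)%C = f x.
Proof.
under eq_bigr => i _ do rewrite mulr_suml.
rewrite exchange_big /= (bigD1 x) //= [X in _ + X]big1 => [|y yx]; last first.
  under eq_bigr => i _ do rewrite -mulrA -rmorphM.
  by rewrite -mulr_sumr -rmorph_sum K_complete (negbTE yx) rmorph0 mulr0.
under eq_bigr => i _ do rewrite -mulrA -rmorphM.
by rewrite -mulr_sumr -rmorph_sum K_complete eqxx rmorph1 mulr1 addr0.
Qed.

Lemma complete_parseval_real (f : J -> R) :
  \sum_i (\sum_x f x * K i x) ^+ 2 = \sum_x f x ^+ 2.
Proof.
under eq_bigr => i _ do rewrite expr2 mulr_suml.
rewrite exchange_big /=; apply: eq_bigr => x _.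
transitivity (\sum_y f x * f y * (x == y)%:R).
  under eq_bigr => i _ do rewrite mulr_sumr.
  rewrite exchange_big /=; apply: eq_bigr => y _.
  by rewrite -K_complete mulr_sumr; apply: eq_bigr => i _; rewrite mulrACA.
rewrite (bigD1 x) //= eqxx mulr1 big1 ?addr0 // => y yx.
by rewrite eq_sym (negbTE yx) mulr0.
Qed.

(** Since [K] is real, real and imaginary parts can be treated separately. *)
Lemma complete_parseval (f : J -> R[i]) :
  \sum_i cabs (\sum_x f x * ((K i x)%:C)%C) ^+ 2 = \sum_x cabs (f x) ^+ 2.
Proof.
under eq_bigr => i _ do rewrite cabs_sqr.
under [RHS]eq_bigr => i _ do rewrite cabs_sqr.
rewrite !big_split /= -!complete_parseval_real.
congr (_ + _); apply: eq_bigr => i _; congr (_ ^+ 2).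
  rewrite raddf_sum; apply: eq_bigr => x _; case: (f x) => a b /=.
  by rewrite mulr0 subr0.
rewrite raddf_sum; apply: eq_bigr => x _; case: (f x) => a b /=.
by rewrite mulr0 add0r.
Qed.

End CompleteFamily.

(** * The Haar transform, and the coefficients of a single scale *)

Section Levels.
Variable R : realType.
#[local] Set Implicit Arguments.
#[local] Unset Strict Implicit.

Let hmx_complete_pair n (x y : 'I_(2 ^ n) * 'I_(2 ^ n)) :
  \sum_(i : 'I_(2 ^ n) * 'I_(2 ^ n))
     hmx R i.1 i.2 x.1 x.2 * hmx R i.1 i.2 y.1 y.2 = (x == y)%:R.
Proof.
case: x y => a b [a' b']; rewrite -hmx_complete /=.
by rewrite pair_bigA.
Qed.

Definition haar_coef n (D : 'M[R[i]]_(2 ^ n)) (p q : nat) : R[i] :=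
  \sum_(a < 2 ^ n) \sum_(b < 2 ^ n) D a b * ((hmx R p q a b)%:C)%C.

Lemma HaarE n (D : 'M[R[i]]_(2 ^ n)) p q : Haar D p q = haar_coef D p q.
Proof.
rewrite mxE; apply: eq_bigr => a _; apply: eq_bigr => b _.
by rewrite haar_basisE.
Qed.

(** Translates the tube constraint to coefficients: [B (Haar_inv (Haar D))] is [B D]. *)
Lemma HaarK n (D : 'M[R[i]]_(2 ^ n)) : Haar_inv (Haar D) = D.
Proof.
apply/matrixP => a b; rewrite /Haar_inv summxE.
rewrite -(complete_recon _ _ _ _ (@hmx_complete_pair n) (fun x => D x.1 x.2) (a, b)).
under eq_bigr => p _ do rewrite summxE.
rewrite pair_bigA; apply: eq_bigr => -[p q] _ /=.
by rewrite mxE haar_basisE HaarE /haar_coef pair_bigA.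
Qed.

Lemma frob_Haar n (D : 'M[R[i]]_(2 ^ n)) : frob (Haar D) = frob D.
Proof.
apply/eqP; rewrite -(@eqrXn2 _ 2) ?frob_ge0 // !frob_sqr.
rewrite -[eqbRHS](complete_parseval _ _ _ _ (@hmx_complete_pair n)
  (fun x => D x.1 x.2)).
apply/eqP/eq_bigr => -[p q] _; rewrite HaarE /haar_coef /=.
by rewrite pair_bigA.
Qed.

Lemma Haar_invD n (X Y : 'M[R[i]]_(2 ^ n)) :
  Haar_inv (X + Y) = Haar_inv X + Haar_inv Y.
Proof.
rewrite /Haar_inv -big_split; apply: eq_bigr => p _.
by rewrite -big_split; apply: eq_bigr => q _; rewrite mxE scalerDl.
Qed.

(** Modulus of the forward difference at [a]; the sum has one term, or none at the last index. *)
Definition step N (f : 'I_N -> R[i]) (a : 'I_N) : R :=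
  \sum_(a' < N | val a' == (val a).+1) cabs (f a' - f a).

Lemma step_ge0 N (f : 'I_N -> R[i]) a : 0 <= step f a.
Proof. by apply: sumr_ge0 => *; exact: cabs_ge0. Qed.

Lemma variation_le N (f : 'I_N -> R[i]) (a0 a : 'I_N) : (a0 <= a)%N ->
  cabs (f a - f a0) <= \sum_(t < N | (a0 <= t < a)%N) step f t.
Proof.
move=> /subnKC; move: (a - a0)%N => d; elim: d a => [|d IH] a ad.
  have -> : a = a0 by apply: val_inj; rewrite /= -ad addn0.
  by rewrite subrr cabs0 sumr_ge0 // => *; exact: step_ge0.
have bN : (a0 + d < N)%N by have := ltn_ord a; rewrite -ad; lia.
pose b := Ordinal bN.
have -> : f a - f a0 = (f b - f a0) + (f a - f b) by ring.
apply: le_trans (cabsD _ _) _.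
rewrite (bigD1 b) /=; last by rewrite -ad; lia.
rewrite [leLHS]addrC; apply: lerD.
  rewrite /step (bigD1 a) /= ?lerDl ?sumr_ge0 // => [*|]; first exact: cabs_ge0.
  by rewrite -ad addnS.
apply: le_trans (IH b erefl) _; rewrite le_eqVlt; apply/orP; left; apply/eqP.
by apply: eq_bigl => t; rewrite -val_eqE /= -ad; lia.
Qed.

Lemma sum_block_size J M k : (k < J)%N -> (0 < M)%N ->
  \sum_(a < J * M) ((val a %/ M)%N == k)%:R = M%:R :> R.
Proof.
move=> kJ M0; rewrite -(big_mkord xpredT (fun a => ((a %/ M)%N == k)%:R)).
rewrite big_nat_mul.
transitivity (\sum_(0 <= i < J) (i == k)%:R * M%:R : R); last first.
  rewrite -mulr_suml big_mkord; under eq_bigr do rewrite eq_sym.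
  by rewrite sum_natr_eq ?mul1r.
apply: eq_bigr => i _.
rewrite (eq_big_nat _ _ (F2 := fun=> (i == k)%:R)) => [|a /andP[h1 h2]].
  by rewrite sumr_const_nat mulSn addnK mulr_natr.
suff -> : (a %/ M)%N = i by [].
by apply/eqP; rewrite eqn_leq -ltnS ltn_divLR // leq_divRL // h1 h2.
Qed.

Section OneLevel.
Variables j i : nat.
(** A dyadic interval of scale [j] holds [2 ^ i.+1] grid points; the successor makes its two halves
    unions of cells. *)
Local Notation n := (j + i.+1)%N.
Local Notation grid e a k :=
  (Hu e (2 ^+ j * ((val a)%:R / (2 ^ n)%:R) - k%:R) : R).

(** Each half of the dyadic interval contains [2 ^ i] grid points, so the values 1 and -1
    balance. *)
Lemma sum_H1_grid k : (k < 2 ^ j)%N -> \sum_(a < 2 ^ n) grid true a k = 0.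
Proof.
move=> kj.
have E (a : nat) : 2 * (2 ^+ j * (a%:R / (2 ^ n)%:R) - k%:R) =
    2 ^+ j.+1 * (a%:R / (2 ^ (j.+1 + i))%:R) - k.*2%:R :> R.
  by rewrite addSnnS exprS -muln2 natrM; ring.
have E' (x : R) : x - k.*2%:R - 1 = x - k.*2.+1%:R by rewrite -natr1; ring.
under eq_bigr => a _.
  rewrite /Hu H1_two_scale !E E' !H0_grid.
  over.
rewrite sumrB -addSnnS expnD !sum_block_size ?subrr ?expn_gt0 //.
  by rewrite expnS; lia.
by rewrite expnS; lia.
Qed.

Lemma grid_H1_bound k (a : 'I_(2 ^ n)) :
  `|grid true a k| <= ((a %/ 2 ^ i.+1)%N == k)%:R.
Proof. by apply: le_trans (Hu_le_H0 _ _) _; rewrite H0_grid. Qed.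

(** Dyadic intervals of one scale are disjoint, so at most one term is nonzero. *)
Lemma sum_grid_le e (a : 'I_(2 ^ n)) : \sum_(k < 2 ^ j) `|grid e a k| <= 1.
Proof.
rewrite -[leRHS](@sum_natr_eq R (2 ^ j) (a %/ 2 ^ i.+1)); last first.
  by rewrite ltn_divLR ?expn_gt0 // -expnD.
by apply: ler_sum => k _; apply: le_trans (Hu_le_H0 _ _) _; rewrite H0_grid.
Qed.

(** By mean zero, [f] may be replaced on each block by its deviation from the first entry, which is
    at most the variation there; a block has [M] points. *)
Lemma sum_H1_coef (f : 'I_(2 ^ n) -> R[i]) :
  \sum_(k < 2 ^ j) cabs (\sum_(a < 2 ^ n) f a * ((grid true a k)%:C)%C) <=
  (2 ^ i.+1)%:R * \sum_(a < 2 ^ n) step f a.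
Proof.
set M := (2 ^ i.+1)%N.
have M0 : (0 < M)%N by rewrite expn_gt0.
have NM : (2 ^ n = 2 ^ j * M)%N by rewrite expnD.
(* [V k] includes the jump leaving block [k], so that the [V k] add up to the whole variation. *)
pose V k := \sum_(t < 2 ^ n | (t %/ M)%N == k) step f t.
have V0 k : 0 <= V k by apply: sumr_ge0 => *; exact: step_ge0.
apply: (@le_trans _ _ (\sum_(k < 2 ^ j) M%:R * V k)).
  apply: ler_sum => k _.
  have kN : (k * M < 2 ^ n)%N by rewrite NM ltn_pmul2r.
  pose a0 := Ordinal kN.
  have -> : \sum_(a < 2 ^ n) f a * ((grid true a k)%:C)%C =
            \sum_(a < 2 ^ n) (f a - f a0) * ((grid true a k)%:C)%C.
    under [RHS]eq_bigr do rewrite mulrBl.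
    by rewrite sumrB -mulr_sumr -rmorph_sum sum_H1_grid // rmorph0 mulr0 subr0.
  apply: le_trans (cabs_sum _ _ _) _.
  apply: (@le_trans _ _ (\sum_(a < 2 ^ n) ((a %/ M)%N == k)%:R * V k)); last first.
    rewrite -mulr_suml NM (sum_block_size _ M0) //.
  apply: ler_sum => a _; rewrite cabsM cabs_real mulrC.
  have := grid_H1_bound k a; rewrite -/M; case: eqP => [ak h|_]; last first.
    by rewrite normr_le0 => /eqP ->; rewrite normr0 !mul0r.
  apply: ler_pM => //; first exact: cabs_ge0.
  apply: le_trans (@variation_le _ f a0 a _) _; first by rewrite /= -ak leq_divM.
  rewrite /V big_mkcond [leRHS]big_mkcond; apply: ler_sum => t _.
  case: ifP => [/= /andP[h1 h2]|_]; last by case: ifP => // _; exact: step_ge0.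
  suff -> : (t %/ M)%N == k by [].
  rewrite eqn_leq leq_divRL // h1 andbT -ltnS ltn_divLR //.
  by apply: leq_ltn_trans (ltnW h2) _; rewrite -ltn_divLR // ak.
rewrite -mulr_sumr ler_wpM2l //.
under eq_bigr do rewrite /V big_mkcond.
rewrite exchange_big /=; apply: ler_sum => t _.
have tj : (t %/ M < 2 ^ j)%N by rewrite ltn_divLR // -NM.
rewrite (bigD1 (Ordinal tj)) //= eqxx big1 ?addr0 // => k.
by rewrite -val_eqE /= eq_sym => /negbTE ->.
Qed.

(** Apply the one-variable bound along the first index for each fixed [b]; summing over [l] costs a
    factor at most 1, for either type [e] of the second variable. *)
Lemma sum_level_coef e (F : 'I_(2 ^ n) -> 'I_(2 ^ n) -> R[i]) :
  \sum_(k < 2 ^ j) \sum_(l < 2 ^ j)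
     cabs (\sum_(a < 2 ^ n) \sum_(b < 2 ^ n) F a b *
       (((2 ^ n)%:R^-1 * (2 ^+ j * grid true a k * grid e b l))%:C)%C) <=
  \sum_(b < 2 ^ n) \sum_(a < 2 ^ n) step (F^~ b) a.
Proof.
pose c : R := (2 ^ n)%:R^-1 * 2 ^+ j.
have c0 : 0 <= c by rewrite mulr_ge0 ?invr_ge0 ?exprn_ge0.
pose P b k := cabs (\sum_(a < 2 ^ n) F a b * ((grid true a k)%:C)%C).
have P0 b k : 0 <= P b k by exact: cabs_ge0.
apply: (@le_trans _ _ (\sum_(k < 2 ^ j) \sum_(l < 2 ^ j) \sum_(b < 2 ^ n)
    c * (`|grid e b l| * P b k))).
  apply: ler_sum => k _; apply: ler_sum => l _.
  rewrite exchange_big /=; apply: le_trans (cabs_sum _ _ _) _.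
  apply: ler_sum => b _.
  have -> : \sum_(a < 2 ^ n) F a b *
       (((2 ^ n)%:R^-1 * (2 ^+ j * grid true a k * grid e b l))%:C)%C =
      (c%:C)%C * (((grid e b l)%:C)%C *
         \sum_(a < 2 ^ n) F a b * ((grid true a k)%:C)%C).
    rewrite !mulr_sumr; apply: eq_bigr => a _.
    by rewrite /c !rmorphM /=; ring.
  by rewrite !cabsM !cabs_real (ger0_norm c0).
under eq_bigr do rewrite exchange_big.
rewrite exchange_big /=; apply: ler_sum => b _.
apply: (@le_trans _ _ (\sum_(k < 2 ^ j) c * P b k)).
  apply: ler_sum => k _; rewrite -mulr_sumr -mulr_suml ler_wpM2l //.
  by rewrite ler_piMl // sum_grid_le.
rewrite -mulr_sumr; apply: le_trans (ler_wpM2l c0 (sum_H1_coef (F^~ b))) _.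
(* The normalisation [c] is exactly the inverse of the block size [2 ^ i.+1]. *)
rewrite mulrA (_ : c * _ = 1) ?mul1r // /c -mulrA -natrX -natrM -expnD.
by rewrite mulVf // pnatr_eq0 expn_eq0.
Qed.

End OneLevel.

End Levels.

(** * The l1 norm of the fine-scale coefficients *)

Section Tail.
Variable R : realType.
#[local] Set Implicit Arguments.
#[local] Unset Strict Implicit.

Lemma TV_step N (D : 'M[R[i]]_N) :
  TV D = \sum_(b < N) \sum_(a < N) step (D^~ b) a +
         \sum_(a < N) \sum_(b < N) step (D a) b.
Proof.
congr (_ + _); rewrite [RHS]exchange_big; apply: eq_bigr => a _ /=.
by rewrite exchange_big.
Qed.

Lemma TV_ge0 N (D : 'M[R[i]]_N) : 0 <= TV D.
Proof.
by rewrite TV_step addr_ge0 //; do 2!(apply: sumr_ge0 => ? _); exact: step_ge0.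
Qed.

Lemma level_coef_sum n L (D : 'M[R[i]]_(2 ^ n)) : (L < n)%N ->
  \sum_(p < 2 ^ L) \sum_(q < 2 ^ L) cabs (haar_coef D p (2 ^ L + q)) +
  (\sum_(p < 2 ^ L) \sum_(q < 2 ^ L) cabs (haar_coef D (2 ^ L + p) q) +
   \sum_(p < 2 ^ L) \sum_(q < 2 ^ L) cabs (haar_coef D (2 ^ L + p) (2 ^ L + q)))
  <= 3 * TV D.
Proof.
move=> Ln; have [i E] : exists i, n = (L + i.+1)%N by exists (n - L.+1)%N; lia.
subst n; have h0 := sum_level_coef false (fun a b => D a b).
have h1 := sum_level_coef true (fun a b => D a b).
(* Type (0,1) oscillates in the second variable only, so the estimate is applied to the
   transpose. *)
have h2 := sum_level_coef false (fun a b => D b a).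
have t1 : 0 <= \sum_(b < 2 ^ (L + i.+1)) \sum_(a < 2 ^ (L + i.+1)) step (D^~ b) a.
  by do 2!(apply: sumr_ge0 => ? _); exact: step_ge0.
have t2 : 0 <= \sum_(a < 2 ^ (L + i.+1)) \sum_(b < 2 ^ (L + i.+1)) step (D a) b.
  by do 2!(apply: sumr_ge0 => ? _); exact: step_ge0.
rewrite TV_step; apply: (@le_trans _ _ (
  \sum_(a < 2 ^ (L + i.+1)) \sum_(b < 2 ^ (L + i.+1)) step (D a) b +
  (\sum_(b < 2 ^ (L + i.+1)) \sum_(a < 2 ^ (L + i.+1)) step (D^~ b) a +
   \sum_(b < 2 ^ (L + i.+1)) \sum_(a < 2 ^ (L + i.+1)) step (D^~ b) a))); last by lra.
apply: lerD; [|apply: lerD].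
- apply: le_trans h2; rewrite exchange_big le_eqVlt; apply/orP; left; apply/eqP.
  apply: eq_bigr => q _; apply: eq_bigr => p _; congr cabs.
  rewrite /haar_coef exchange_big; apply: eq_bigr => b _; apply: eq_bigr => a _.
  by rewrite /hmx haar_basis_fun01 // /Haar2 /= mulrAC.
- apply: le_trans h0; rewrite le_eqVlt; apply/orP; left; apply/eqP.
  apply: eq_bigr => p _; apply: eq_bigr => q _; congr cabs.
  apply: eq_bigr => a _; apply: eq_bigr => b _.
  by rewrite /hmx haar_basis_fun10.
- apply: le_trans h1; rewrite le_eqVlt; apply/orP; left; apply/eqP.
  apply: eq_bigr => p _; apply: eq_bigr => q _; congr cabs.
  apply: eq_bigr => a _; apply: eq_bigr => b _.
  by rewrite /hmx haar_basis_fun11.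
Qed.

(** In the pyramid layout this corner square holds the constant and all scales below [j]. *)
Definition coarse (n j : nat) : {set 'I_(2 ^ n) * 'I_(2 ^ n)} :=
  [set i : 'I_(2 ^ n) * 'I_(2 ^ n) | (i.1 < 2 ^ j)%N && (i.2 < 2 ^ j)%N].

Lemma card_coarse n j : (#|coarse n j| <= 4 ^ j)%N.
Proof.
(* [inord] requires an ordinal type of successor size. *)
pose f (i : 'I_(2 ^ n) * 'I_(2 ^ n)) : 'I_(2 ^ j).-1.+1 * 'I_(2 ^ j).-1.+1 :=
  (inord i.1, inord i.2).
have E : (2 ^ j).-1.+1 = (2 ^ j)%N by rewrite prednK // expn_gt0.
have /card_in_imset <- : {in coarse n j &, injective f}.
  move=> [p q] [p' q']; rewrite !inE /= => /andP[h1 h2] /andP[h3 h4] e.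
  have := congr1 (fun x => val x.1) e; have := congr1 (fun x => val x.2) e.
  rewrite /= !inordK ?E // => e2 e1.
  by congr (_, _); apply: val_inj.
apply: leq_trans (max_card _) _.
by rewrite card_prod !card_ord E -expnMn.
Qed.

(** Induction on [L - j]: each doubling of the box adds the three quadrants of one scale, at a cost
    of [3 * TV D]. *)
Lemma fine_coef_sum n j L (D : 'M[R[i]]_(2 ^ n)) : (j <= L <= n)%N ->
  \sum_(p < 2 ^ L) \sum_(q < 2 ^ L)
    (if (p < 2 ^ j)%N && (q < 2 ^ j)%N then 0 else cabs (haar_coef D p q)) <=
  (L - j)%:R * (3 * TV D).
Proof.
move=> /andP[/subnKC <-]; rewrite addKn; move: (L - j)%N => d.
elim: d => [|d IH] dn.
  rewrite addn0 mul0r big1 // => p _; rewrite big1 // => q _.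
  by rewrite !ltn_ord.
rewrite addnS expnS mul2n (sum_box_double _ (fun p q =>
  if (p < 2 ^ j)%N && (q < 2 ^ j)%N then 0 else cabs (haar_coef D p q))).
rewrite -natr1 mulrDl mul1r; apply: lerD; first by apply: IH; lia.
have le0 (b : bool) z : (if b then 0 else cabs z) <= cabs z :> R.
  by case: b => //; exact: cabs_ge0.
apply: le_trans (@level_coef_sum n (j + d) D _); last by lia.
by apply: lerD; [|apply: lerD]; do 2!(apply: ler_sum => ? _); exact: le0.
Qed.

Lemma fine_Haar_sum n j (D : 'M[R[i]]_(2 ^ n)) : (j <= n)%N ->
  \sum_(i in ~: coarse n j) cabs (Haar D i.1 i.2) <= (n - j)%:R * (3 * TV D).
Proof.
move=> jn; apply: le_trans (@fine_coef_sum n j n D _); last by rewrite jn leqnn.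
rewrite big_mkcond pair_bigA le_eqVlt; apply/orP; left; apply/eqP.
by apply: eq_bigr => -[p q] _; rewrite !inE HaarE /=; case: (_ && _).
Qed.

End Tail.

(** * Consequences of the restricted isometry property *)

Section RestrictedIsometry.
Variables (R : realType) (N m : nat) (A : 'M[R[i]]_N -> 'cV[R[i]]_m).
Variables (s : nat) (delta d : R).
Hypothesis A_add : forall X Y, A (X + Y) = A X + A Y.
Hypothesis A_RIP : RIP A (2 * s) delta.
Hypothesis delta_d : delta <= d.
Hypotheses (d0 : 0 <= d) (d1 : d < 1).
Let alpha : R := Num.sqrt (1 - d).
Let beta : R := Num.sqrt (1 + d).

Lemma RIP_lower X : (nnz X <= 2 * s)%N -> alpha * frob X <= frob (A X).
Proof.
move=> /A_RIP/andP[h _]; rewrite -(@ler_pXn2r _ 2) ?nnegrE ?frob_ge0 //; last first.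
  by rewrite mulr_ge0 ?sqrtr_ge0 ?frob_ge0.
rewrite exprMn [alpha ^+ 2]sqr_sqrtr ?subr_ge0 ?(ltW d1) //.
by apply: le_trans h; rewrite ler_wpM2r ?sqr_ge0 // lerD2l lerN2.
Qed.

Lemma RIP_upper X : (nnz X <= 2 * s)%N -> frob (A X) <= beta * frob X.
Proof.
move=> /A_RIP/andP[_ h]; rewrite -(@ler_pXn2r _ 2) ?nnegrE ?frob_ge0 //; last first.
  by rewrite mulr_ge0 ?sqrtr_ge0 ?frob_ge0.
rewrite exprMn [beta ^+ 2]sqr_sqrtr ?addr_ge0 //.
by apply: le_trans h _; rewrite ler_wpM2r ?sqr_ge0 // lerD2l.
Qed.

Lemma frobN (X : 'cV[R[i]]_m) : frob (- X) = frob X.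
Proof.
apply/eqP; rewrite -(@eqrXn2 _ 2) ?frob_ge0 // !frob_sqr; apply/eqP.
apply: eq_bigr => i _; rewrite mxE -mulN1r cabsM.
have -> : cabs (- 1 : R[i]) = 1; last by rewrite mul1r.
by have := cabs_real (-1 : R); rewrite rmorphN1 normrN1.
Qed.

(** The head [S :|: V] has at most [2 * s] entries, so the lower bound applies to it. The rest [W]
    costs [alpha * E] for its own norm and [beta * E] for its image. *)
Lemma RIP_tail_bound (X : 'M[R[i]]_N) (S : {set 'I_N * 'I_N}) :
  (0 < s)%N -> (#|S| <= s)%N -> (2 * s < N ^ 2)%N ->
  alpha * frob X <= frob (A X) + (alpha + beta) *
    ((\sum_(i in ~: S) cabs (X i.1 i.2)) / Num.sqrt s%:R).
Proof.
move=> s0 cS sN; set x := fun i : 'I_N * 'I_N => cabs (X i.1 i.2).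
have x0 i : 0 <= x i by exact: cabs_ge0.
have b0 : 0 < beta by rewrite sqrtr_gt0 ltr_pwDl.
(* Since [2 * s < N ^ 2], enough entries lie outside [S] to choose [s] of them. *)
have sT : (s.-1 < #|~: S|)%N.
  have := finset.cardsC S; rewrite card_prod card_ord -mulnn in sN *; lia.
have [V [t [VS cV t0 Vt St]]] := top_set _ _ x x0 _ _ sT.
rewrite prednK // in cV; pose W := ~: S :\: V.
have Wx : Num.sqrt s%:R * t + (\sum_(i in W) x i) / Num.sqrt s%:R <=
          (\sum_(i in ~: S) x i) / Num.sqrt s%:R.
  by have := top_peel _ _ x s.-1 _ _ t VS; rewrite prednK //; apply.
set E := (X in _ <= X) in Wx.
have maskU (U V' : {set 'I_N * 'I_N}) : [disjoint U & V'] ->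
    frob (mxmask X (U :|: V')) <= frob (mxmask X U) + frob (mxmask X V').
  by move=> /mxmask_setU ->; exact: frobD.
have W1 : frob (mxmask X W) <= E.
  apply: le_trans Wx; apply: (block_bound R _ x x0 (fun U => frob (mxmask X U))) => //.
  by move=> U u cU u0 Uu; exact: frob_mxmask_le.
have W2 : frob (A (mxmask X W)) <= beta * E.
  rewrite mulrC -ler_pdivrMr //; apply: le_trans Wx.
  (* Dividing by [beta] makes the upper isometry bound on one block the hypothesis of
     [block_bound]. *)
  apply: (block_bound R _ x x0 (fun U => frob (A (mxmask X U)) / beta)) => //.
    move=> U V' /mxmask_setU ->; rewrite A_add -mulrDl ler_wpM2r ?frobD //.
    by rewrite invr_ge0 ltW.
  move=> U u cU u0 Uu; rewrite ler_pdivrMr // mulrC.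
  apply: le_trans (RIP_upper _ _) _.
    by rewrite (leq_trans (nnz_mxmask _ _)) // (leq_trans cU) // leq_pmull.
  by rewrite (ler_wpM2l (ltW b0)) // frob_mxmask_le.
have dis : [disjoint S :|: V & W].
  rewrite -finset.setI_eq0; apply/eqP/setP => i; rewrite !inE.
  by case: (i \in S); case: (i \in V).
have eX : X = mxmask X (S :|: V) + mxmask X W.
  rewrite -mxmask_setU //; apply/esym.
  suff -> : S :|: V :|: W = [set: 'I_N * 'I_N] by exact: mxmask_setT.
  by apply/setP => i; rewrite !inE; case: (i \in S); case: (i \in V).
have l1 : alpha * frob (mxmask X (S :|: V)) <= frob (A (mxmask X (S :|: V))).
  apply: RIP_lower; apply: leq_trans (nnz_mxmask _ _) _.
  by rewrite (leq_trans (leq_card_setU _ _)) // cV mul2n -addnn leq_add2r.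
have l2 : frob (A (mxmask X (S :|: V))) <= frob (A X) + frob (A (mxmask X W)).
  have -> : A (mxmask X (S :|: V)) = A X - A (mxmask X W).
    by rewrite {2}eX A_add addrK.
  by rewrite -(frobN (A (mxmask X W))) frobD.
have l3 : frob X <= frob (mxmask X (S :|: V)) + frob (mxmask X W).
  by rewrite {1}eX frobD.
have a0 : 0 <= alpha by exact: sqrtr_ge0.
have h1 := ler_wpM2l a0 l3; have h2 := ler_wpM2l a0 W1.
suff: alpha * frob X <= frob (A X) + (alpha + beta) * E by [].
rewrite mulrDr in h1; rewrite mulrDl; lra.
Qed.

End RestrictedIsometry.

(** * Choice of the cut-off scale, and conclusion *)

(** As s < 4^(j+1), all but one of the [n - j] scales are paid for by one logarithm. The last costs
    [2 * ln 2], at most two more logarithms because N^2/s > 2; hence the factor 3. *)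
Lemma coarse_scale (R : realType) (n s : nat) :
  (1 <= s)%N -> (2 * s < (2 ^ n) ^ 2)%N ->
  exists2 j : nat, (j <= n)%N && (4 ^ j <= s)%N &
    (n - j)%:R * (2 * ln 2) <= 3 * ln (((2 ^ n) ^ 2)%:R / s%:R) :> R.
Proof.
move=> s1 sN; have [j0 j1] := andP (trunc_log_bounds (isT : (1 < 4)%N) s1).
move: (trunc_log 4 s) j0 j1 => j j0 j1.
have N4 : ((2 ^ n) ^ 2 = 4 ^ n)%N by rewrite -expnM mulnC expnM.
have s0 : 0 < s%:R :> R by rewrite ltr0n.
have jn : (j < n)%N by rewrite -(@ltn_exp2l 4) //; lia.
exists j; first by rewrite j0 ltnW.
have l2 : 0 <= ln 2 :> R by rewrite ln_ge0 // ler1n.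
have h1 : ln 2 <= ln (((2 ^ n) ^ 2)%:R / s%:R) :> R.
  rewrite ler_ln ?posrE ?divr_gt0 ?ltr0n ?expn_gt0 //.
  by rewrite ler_pdivlMr // -natrM ler_nat ltnW.
have h2 : (n - j.+1)%:R * (2 * ln 2) <= ln (((2 ^ n) ^ 2)%:R / s%:R) :> R.
  have -> : (n - j.+1)%:R * (2 * ln 2) = ln ((4 ^ (n - j.+1))%:R : R).
    rewrite natrX lnXn // (_ : 4%:R = 2 ^+ 2); last by ring.
    by rewrite lnXn // !mulr_natl.
  rewrite ler_ln ?posrE ?divr_gt0 ?ltr0n ?expn_gt0 //.
  rewrite ler_pdivlMr // -natrM ler_nat N4 -[in leqRHS](subnK jn) expnD.
  by rewrite leq_mul2l ltnW ?orbT.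
have -> : (n - j)%:R = (n - j.+1)%:R + 1 :> R by rewrite natr1 -subSn.
lra.
Qed.

Theorem theorem8 (R : realType) (delta : R) :
  delta < 1 ->
  exists Cst : R, 0 < Cst /\
  forall (n m s : nat) (B : {linear 'M[R[i]]_(2 ^ n) -> 'cV[R[i]]_m})
         (D : 'M[R[i]]_(2 ^ n)) (eps : R),
    (1 <= s <= (2 ^ n) ^ 2)%N ->
    RIP (fun X => B (Haar_inv X)) (2 * s) delta ->
    frob (B D) <= eps ->
    frob D <= Cst * (TV D / Num.sqrt (s%:R) * ln (((2 ^ n) ^ 2)%:R / s%:R) + eps).
Proof.
(* delta may be below -1, where Num.sqrt (1 + delta) would be the junk value 0. *)
move=> delta1; pose d := Num.max delta 0.
have dd : delta <= d by rewrite le_max lexx.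
have d0 : 0 <= d by rewrite le_max lexx orbT.
have d1 : d < 1 by rewrite gt_max delta1 ltr01.
pose alpha := Num.sqrt (1 - d); pose beta := Num.sqrt (1 + d).
have a0 : 0 < alpha by rewrite sqrtr_gt0; lra.
have b0 : 0 < beta by rewrite sqrtr_gt0; lra.
have l2 : 0 < ln 2 :> R by rewrite ln_gt0 // ltr1n.
(* The 9 is 3 from the [3 * TV D] per scale times 3 from [coarse_scale], which also supplies
   [2 * ln 2]. *)
pose K := (alpha + beta) * (9 / (2 * ln 2)).
have K0 : 0 < K by rewrite mulr_gt0 ?addr_gt0 // divr_gt0 // mulr_gt0.
(* The 1 absorbs [eps], [K] absorbs the tail, and [alpha] comes from the lower isometry bound. *)
exists ((1 + K) / alpha); split; first by rewrite divr_gt0 // addr_gt0.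
move=> n m s B D eps /andP[s1 sN] rip tube.
set A := fun X => B (Haar_inv X) in rip.
have A_add X Y : A (X + Y) = A X + A Y by rewrite /A Haar_invD linearD.
have AD : frob (A (Haar D)) <= eps by rewrite /A HaarK.
have eps0 : 0 <= eps := le_trans (frob_ge0 _) tube.
have r0 : 0 < Num.sqrt s%:R :> R by rewrite sqrtr_gt0 ltr0n.
set T := TV D / Num.sqrt s%:R.
have T0 : 0 <= T by rewrite divr_ge0 ?TV_ge0 // ltW.
set l := ln _.
have l0 : 0 <= l.
  by rewrite ln_ge0 // ler_pdivlMr ?ltr0n // mul1r ler_nat.
have Tl0 : 0 <= T * l by exact: mulr_ge0.
rewrite -mulrA mulrCA mulrC -ler_pdivrMr ?invr_gt0 // invrK mulrC -frob_Haar.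
(* If [2 * s] reaches N^2, every array is sparse enough for the lower isometry bound, and [eps]
   alone suffices; the logarithm may vanish here, at s = N^2. *)
have [Ns|sN2] := leqP ((2 ^ n) ^ 2) (2 * s).
  apply: (@le_trans _ _ eps).
    apply: le_trans AD; apply: (RIP_lower _ _ _ A s delta d) => //.
    apply: leq_trans (max_card _) _; rewrite card_prod card_ord.
    by rewrite -mulnn in Ns.
  have := mulr_ge0 (ltW K0) Tl0; have := mulr_ge0 (ltW K0) eps0.
  by rewrite mulrDr !mulrDl; lra.
have [j /andP[jn js] jl] := coarse_scale R n s s1 sN2.
have cj : (#|coarse n j| <= s)%N := leq_trans (card_coarse n j) js.
have := RIP_tail_bound _ _ _ A s delta d A_add rip dd d0 d1 (Haar D) _ s1 cj sN2.
rewrite -/alpha -/beta => h; apply: le_trans h _.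
have hT : (\sum_(i in ~: coarse n j) cabs (Haar D i.1 i.2)) / Num.sqrt s%:R <=
    9 / (2 * ln 2) * (T * l).
  apply: le_trans (ler_wpM2r _ (fine_Haar_sum D jn)) _.
    by rewrite invr_ge0 ltW.
  have -> : (n - j)%:R * (3 * TV D) / Num.sqrt s%:R = (n - j)%:R * (3 * T).
    by rewrite /T; ring.
  have -> : 9 / (2 * ln 2) * (T * l) = 3 * l / (2 * ln 2) * (3 * T).
    by field; rewrite gt_eqF.
  by apply: ler_wpM2r; [exact: mulr_ge0 | rewrite ler_pdivlMr ?mulr_gt0].
have ab : 0 <= alpha + beta by rewrite addr_ge0 // ltW.
have := ler_wpM2l ab hT; rewrite [leRHS]mulrA -/K => hK.
apply: le_trans (lerD AD hK) _.
have := mulr_ge0 (ltW K0) eps0.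
by rewrite mulrDr !mulrDl; lra.
Qed.
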